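(* There does not exist a total order $\prec$ on $\mathbb{Z}^2$ (under which the elements of $\mathbb{Z}^2$ form a sequence $x_1\prec x_2\prec x_3\prec\cdots$) such that $$\|\nabla u^{\#}\|_2\le \|\nabla u\|_2$$ holds for all nonnegative functions $u:\mathbb{Z}^2\to[0,\infty)$ vanishing at infinity, where $u^{\#}$ is the $\prec$-decreasing rearrangement of $u$.
   Context: $\mathbb{Z}^2$ is regarded as the lattice graph: $x\sim y$ iff $x-y\in\{\pm e_1,\pm e_2\}$, with $e_1,e_2$ the standard unit vectors. For $u:\mathbb{Z}^2\to\mathbb{R}$, $\|\nabla u\|_2^2=\frac12\sum_{x}\sum_{y\sim x}|u(x)-u(y)|^2\in[0,\infty]$. A function $u:\mathbb{Z}^2\to[0,\infty)$ vanishes at infinity if $\{x:u(x)>t\}$ is finite for every $t>0$. Its $n$-th largest value (with multiplicity) is $a_n=\sup_{\Omega\subset\mathbb{Z}^2,\,|\Omega|=n}\min_{x\in\Omega}u(x)$, $n\ge1$. Given a total order $\prec$ on $\mathbb{Z}^2$ under which the elements form a sequence $x_1\prec x_2\prec\cdots$ (exhausting $\mathbb{Z}^2$), the $\prec$-decreasing rearrangement of $u$ is the function $u^{\#}$ with $u^{\#}(x_i)=a_i$ for all $i\ge1$. *)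

(* Defs.v *)
From mathcomp Require Import all_boot all_order all_algebra.
From mathcomp Require Import finmap.
From mathcomp Require Import all_classical all_reals all_analysis.
Set Implicit Arguments.
Unset Strict Implicit.
Unset Printing Implicit Defensive.
Import Order.TTheory GRing.Theory Num.Theory.
Local Open Scope classical_set_scope.
Local Open Scope ring_scope.

Notation Z2 := (int * int)%type.

Definition e1 : Z2 := (1, 0).
Definition e2 : Z2 := (0, 1).

Definition adj (x y : Z2) : bool := x - y \in [:: e1; - e1; e2; - e2].

Definition grad_norm (R : realType) (u : Z2 -> R) : \bar R :=
  sqrte ((2^-1)%:E *
    \esum_(x in [set: Z2]) \esum_(y in [set y | adj x y])
      (`|u x - u y| ^+ 2)%:E)%E.

Definition vanishes_at_infinity (R : realType) (u : Z2 -> R) : Prop :=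
  forall t : R, 0 < t -> finite_set [set x | t < u x].

Definition is_min (R : realType) (A : set R) (m : R) : Prop :=
  A m /\ lbound A m.

(* Meaningful for [1 <= n] and [u] bounded above (in particular when [u]
   vanishes at infinity); otherwise the real [sup] takes a default value. *)
Definition nth_largest (R : realType) (u : Z2 -> R) (n : nat) : R :=
  sup [set m | exists2 O : {fset Z2},
                 #|` O|%fset = n & is_min (u @` [set` O]) m].

Definition strict_total_order (T : eqType) (prec : rel T) : Prop :=
  [/\ irreflexive prec, transitive prec
    & forall x y, x != y -> prec x y || prec y x].

(* Indices are 0-based: [x i] is the (i+1)-st element of the sequence. *)
Definition enumerates (prec : rel Z2) (x : nat -> Z2) : Prop :=
  {homo x : i j / (i < j)%N >-> prec i j} /\ forall y, exists i, x i = y.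

Definition is_rearrangement (R : realType) (x : nat -> Z2)
    (u v : Z2 -> R) : Prop :=
  forall i, v (x i) = nth_largest u i.+1.

Lemma rearrangement_exists_unique (R : realType) (prec : rel Z2)
    (x : nat -> Z2) (u : Z2 -> R) :
  strict_total_order prec -> enumerates prec x ->
  exists! v : Z2 -> R, is_rearrangement x u v.
Proof.
move=> [irr _ _] [xlt /choice[f fK]].
have xI : injective x.
  move=> i j eqx; case: (ltngtP i j) => // /xlt; by rewrite eqx irr.
exists (fun y => nth_largest u (f y).+1); split=> [i|v vP].
  by congr (nth_largest u _.+1); apply: xI; rewrite fK.
by apply/funext => y; rewrite -[in RHS](fK y) vP.
Qed.

(* Main.v *)
Require Import Defs.
From mathcomp Require Import all_boot all_order all_algebra.
From mathcomp Require Import finmap zify.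
From mathcomp Require Import all_classical all_reals all_analysis.
Import Order.TTheory GRing.Theory Num.Theory.
Local Open Scope ring_scope.

(** Two competing test functions rule out every order.  Write [x 0], [x 1], ...
    for the points of the order, and call plus the set made of the origin and
    its four neighbours.

    A tall spike on a plus forces the first five points to form a plus.  Let
    [u] be 8 at the origin, 1 at its neighbours and 0 elsewhere.  Counting each
    edge in both directions, its energy is 2 (4 * 49 + 12) = 416.  The
    rearranged function is 8 at [x 0] and 1 at [x 1], ..., [x 4].  If one
    neighbour of [x 0] is not among these, the four edges at [x 0] alone
    contribute at least 2 (64 + 3 * 49) = 422: the spike is so high that saving
    perimeter elsewhere cannot pay for a drop from 8 to 0.  Hence the first five
    points are a plus centred at [x 0] ([spike_neighbours]).

    But a plus is not optimal for the perimeter.  The indicator function of a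
    pentomino that fits in a 2 x 3 rectangle has perimeter 10, and its
    rearrangement is the indicator function of the first five points, a plus,
    of perimeter 12 ([energy_indicator_plus]).  So the inequality fails for
    one of the two functions.

    Both test functions take finitely many natural values, in decreasing order
    along a finite list of points; [layered_rearrangement] says that rearranging
    moves the same values to an initial segment of the order, and [esum_energy]
    turns the Dirichlet energy into a finite sum in [nat] that evaluates by
    computation. *)

(** * Dirichlet energy as a finite sum of natural numbers *)

Definition steps : seq Z2 := [:: e1; - e1; e2; - e2].

Lemma steps_opp d : (- d \in steps) = (d \in steps).
Proof. by rewrite !inE !eqr_oppLR !opprK orbCA [in LHS](orbC (d == - e2)). Qed.

Definition local_energy (f : Z2 -> nat) (z : Z2) : nat :=
  sumn [seq (absz ((f z)%:Z - (f (z + d))%:Z)%R ^ 2)%N | d <- steps].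

(** Each edge inside [K] is counted in both directions. The sums are [sumn]
    over explicit lists, rather than big operators, so that they compute. *)
Definition energy (f : Z2 -> nat) (K : seq Z2) : nat :=
  sumn [seq local_energy f z | z <- K].

(** The function with value [vals`_i] at the [i]-th point of [s], and 0 off
    [s] when [vals] is not longer than [s]: the index of a point off [s] is
    [size s], where [nth] takes its default value. *)
Definition layered (s : seq Z2) (vals : seq nat) (z : Z2) : nat :=
  nth 0%N vals (index z s).

Definition nbhd (s : seq Z2) : seq Z2 :=
  undup (s ++ [seq z + d | z <- s, d <- steps]).

Lemma sumn_natr_EFin (R : realType) (T : Type) (F : T -> nat) (s : seq T) :
  (sumn [seq F i | i <- s])%:R%:E = (\sum_(i <- s) (F i)%:R%:E)%E :> \bar R.
Proof. by rewrite sumEFin -natr_sum sumnE big_map. Qed.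

Lemma adjE z y : adj z y = (y \in [seq z + d | d <- steps]).
Proof.
apply/idP/mapP => [zy|[d ds ->]].
  by exists (y - z); rewrite ?subrKC // -steps_opp opprB.
by rewrite /adj opprD addNKr steps_opp.
Qed.

Lemma esum_adj (R : realType) (f : Z2 -> nat) (z : Z2) :
  (\esum_(y in [set y | adj z y])
      (`|(f z)%:R - (f y)%:R : R| ^+ 2)%:E)%E = (local_energy f z)%:R%:E.
Proof.
have -> : [set y | adj z y]%classic = [set` [seq z + d | d <- steps]]%classic.
  by apply/seteqP; split=> y; rewrite /mkset adjE.
rewrite esum_fset; last 2 first.
- exact: finite_seq.
- by move=> i _; rewrite lee_fin exprn_ge0.
rewrite -fsbig_seq; last by rewrite map_inj_uniq //; exact: addrI.
rewrite big_map /local_energy sumn_natr_EFin; apply: eq_bigr => d _.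
by rewrite natrX natr_absz intr_norm intrB.
Qed.

(** Local energies are nonnegative, so any finite window bounds the total energy
    from below; this is all that is used of a rearranged function. *)
Lemma energy_le_esum (R : realType) (f : Z2 -> nat) (K : seq Z2) : uniq K ->
  ((energy f K)%:R%:E <=
   \esum_(z in [set: Z2]) \esum_(y in [set y | adj z y])
      (`|(f z)%:R - (f y)%:R : R| ^+ 2)%:E)%E.
Proof.
move=> uK; under eq_esum do rewrite esum_adj.
apply: esum_ge; exists [set` K]%classic; first by split=> //; exact: finite_seq.
by rewrite -fsbig_seq // -sumn_natr_EFin.
Qed.

Lemma esum_energy (R : realType) (f : Z2 -> nat) (K : seq Z2) : uniq K ->
  (forall z, z \notin K -> local_energy f z = 0%N) ->
  (\esum_(z in [set: Z2]) \esum_(y in [set y | adj z y])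
      (`|(f z)%:R - (f y)%:R : R| ^+ 2)%:E)%E = (energy f K)%:R%:E.
Proof.
move=> uK K0; under eq_esum do rewrite esum_adj.
have -> : (\esum_(z in [set: Z2]) (local_energy f z)%:R%:E =
  \esum_(z in [set` K]) (local_energy f z)%:R%:E :> \bar R)%E.
  rewrite [RHS]esum_mkcond; apply: eq_esum => z _.
  by rewrite mem_setE; case: ifPn => // /K0 ->.
rewrite esum_fset -?fsbig_seq -?sumn_natr_EFin //; exact: finite_seq.
Qed.

Lemma layered_out s vals z : (size vals <= size s)%N -> z \notin s ->
  layered s vals z = 0%N.
Proof. by move=> vs zs; rewrite /layered nth_default // (memNindex zs). Qed.

Lemma local_energy_nbhd s vals z : (size vals <= size s)%N ->
  z \notin nbhd s -> local_energy (layered s vals) z = 0%N.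
Proof.
move=> vs; rewrite mem_undup mem_cat negb_or => /andP[zs zN].
rewrite /local_energy sumnE big_map big1_seq // => d /= ds.
rewrite !layered_out //; apply: contra zN => zds.
apply/allpairsP; exists (z + d, - d); split; rewrite ?steps_opp //=.
by rewrite addrK.
Qed.

(** * Rearranging a finitely supported function *)

(** The list [O] makes [c] a candidate for the supremum. No candidate exceeds
    [c], for [size O] points on which [u > c] would have to fit into the
    smaller list [K]. *)
Lemma nth_largest_eq (R : realType) (u : Z2 -> R) (c : R) (O K : seq Z2) :
  uniq O -> (exists2 z, z \in O & u z = c) ->
  (forall z, z \in O -> c <= u z) ->
  (forall z, c < u z -> z \in K) -> (size K < size O)%N ->
  nth_largest u (size O) = c.
Proof.
move=> uO [z0 z0O uz0] cO cK KO.
rewrite /nth_largest; set S := (X in sup X).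
have Sc : S c.
  exists [fset z in O]%fset; first by rewrite card_fseq undup_id.
  split; first by exists z0 => //=; rewrite in_fset.
  by move=> _ [z /= + <-]; rewrite in_fset => /cO.
have ubS : ubound S c.
  move=> m [F Fn [_ mF]]; rewrite leNgt; apply/negP => cm.
  have : (size F <= size K)%N.
    apply: uniq_leq_size; first exact: fset_uniq.
    by move=> z zF; apply: cK; apply: lt_le_trans cm _; apply: mF; exists z.
  by rewrite Fn leqNgt KO.
apply/eqP; rewrite eq_le; apply/andP; split.
  by apply: ge_sup => //; exists c.
by apply: ub_le_sup => //; exists c.
Qed.

(** For [i < size s] the [i.+1] first points of [s] realise the maximum, as the
    points with a larger value are among the [i] first ones. For larger [i] any
    [i.+1] points will do, since one of them is off [s]; the sequence [x] serves
    only to supply them. *)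
Lemma nth_largest_layered (R : realType) (x : nat -> Z2) (s : seq Z2)
    (vals : seq nat) (i : nat) :
  injective x -> uniq s -> size vals = size s -> sorted geq vals ->
  nth_largest (fun z => (layered s vals z)%:R : R) i.+1 = (nth 0%N vals i)%:R.
Proof.
move=> xI us vs vals_sorted.
have anti a b : (a <= b)%N -> (nth 0%N vals b <= nth 0%N vals a)%N.
  move=> ab; case: (ltnP b (size vals)) => [bv|?]; last by rewrite nth_default.
  have geq_trans : transitive geq by move=> p q r qp pr; exact: leq_trans pr qp.
  apply: (sorted_leq_nth geq_trans leqnn) => //; rewrite inE //.
  exact: leq_ltn_trans bv.
case: (ltnP i (size s)) => [is_|si].
- have <- : size (take i.+1 s) = i.+1 by rewrite size_takel.
  apply: (nth_largest_eq _ _ _ _ (take i s)).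
  + exact: take_uniq.
  + exists (nth 0 s i); first by rewrite in_take ?mem_nth // index_uniq.
    by rewrite /layered index_uniq.
  + by move=> z /index_ltn zi; rewrite ler_nat anti.
  + move=> z; rewrite ltr_nat /layered => iz.
    have zi : (index z s < i)%N.
      by rewrite ltnNge; apply/negP => /anti; rewrite leqNgt iz.
    by rewrite in_take // -index_mem (ltn_trans zi).
  + by rewrite !size_takel //; exact: ltnW.
- have sO : size (mkseq x i.+1) = i.+1 by rewrite size_mkseq.
  rewrite nth_default ?vs // -[in LHS]sO.
  have uO : uniq (mkseq x i.+1) by rewrite mkseq_uniq.
  apply: (nth_largest_eq _ _ _ _ s) => //.
  + have /allPn[z zO zs] : ~~ all [in s] (mkseq x i.+1).
      by apply/allP => /(uniq_leq_size uO); rewrite size_mkseq ltnNge si.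
    by exists z => //; rewrite layered_out ?vs.
  + move=> z; rewrite ltr_nat => z0; apply: contraTT z0 => zs.
    by rewrite layered_out ?vs.
  + by rewrite size_mkseq.
Qed.

Lemma layered_vanishes (R : realType) s vals : size vals = size s ->
  vanishes_at_infinity (fun z => (layered s vals z)%:R : R).
Proof.
move=> vs t t0; apply: (@sub_finite_set _ _ [set` s]%classic);
  last exact: finite_seq.
move=> z /=; apply: contraTT => zs.
by rewrite layered_out ?vs // -leNgt ltW.
Qed.

Lemma layered_rearrangement (R : realType) (x : nat -> Z2) (s : seq Z2)
    (vals : seq nat) :
  injective x -> uniq s -> size vals = size s -> sorted geq vals ->
  is_rearrangement x (fun z => (layered s vals z)%:R : R)
    (fun z => (layered (mkseq x (size s)) vals z)%:R).
Proof.
move=> xI us vs sv i; rewrite (nth_largest_layered R x) // /layered; congr _%:R.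
case: (ltnP i (size s)) => si; last first.
  have xi : x i \notin mkseq x (size s).
    apply/mapP => -[j]; rewrite mem_iota => /andP[_ js] /xI ij.
    by move: js; rewrite -ij ltnNge si.
  by rewrite (memNindex xi) size_mkseq !nth_default ?vs.
by rewrite -[in index _ _](nth_mkseq 0 x si) index_uniq ?size_mkseq ?mkseq_uniq.
Qed.

(** The Polya-Szego inequality for layered functions, as a comparison of two
    natural numbers. The window [K] is arbitrary because it only gives a lower
    bound for the rearranged energy. *)
Lemma layered_energy_le (R : realType) (x : nat -> Z2) (s K : seq Z2)
    (vals : seq nat) :
  injective x ->
  (forall u v : Z2 -> R, (forall z, 0 <= u z) -> vanishes_at_infinity u ->
     is_rearrangement x u v -> (grad_norm v <= grad_norm u)%E) ->
  uniq s -> uniq K -> size vals = size s -> sorted geq vals ->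
  (energy (layered (mkseq x (size s)) vals) K <=
   energy (layered s vals) (nbhd s))%N.
Proof.
move=> xI H us uK vs sv.
have := H _ _ (fun=> ler0n _ _) (layered_vanishes R _ _ vs)
  (layered_rearrangement R x _ _ xI us vs sv).
rewrite /grad_norm lee_sqrt; last first.
  by rewrite mule_ge0 ?lee_fin ?invr_ge0 // esum_ge0 // => z _;
    rewrite esum_adj lee_fin.
rewrite lee_pmul2l ?lte_fin ?invr_gt0 //.
rewrite (@esum_energy _ (layered s vals) (nbhd s)) ?undup_uniq //; last first.
  by move=> z; apply: local_energy_nbhd; rewrite vs.
move=> {}H; rewrite -(ler_nat R) -lee_fin.
apply: le_trans (energy_le_esum R _ _ uK) H.
Qed.

(** * The spike on a plus, and the pentomino *)

Definition plus : seq Z2 := 0 :: steps.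
Definition pentomino : seq Z2 := [:: (0, 0); (1, 0); (0, 1); (1, 1); (2, 0)].

Lemma local_energy_ge f z d : d \in steps ->
  (absz ((f z)%:Z - (f (z + d))%:Z)%R ^ 2 <= local_energy f z)%N.
Proof.
by move=> ds; rewrite /local_energy sumnE big_map (big_rem d) //= leq_addr.
Qed.

(** The window is the plus centred at [c] itself: each of the four edges at [c]
    is seen from both of its ends. If all four neighbours of [c] had value 1 the
    four edges would contribute [2 * 4 * 49 = 392]; a neighbour off [c :: s] has
    value 0 and raises this by [2 * 15] to 422, above the 416 allowed. *)
Lemma spike_neighbours (c : Z2) (s : seq Z2) : size s = 4%N ->
  (energy (layered (c :: s) [:: 8; 1; 1; 1; 1]%N) [seq (c + z)%R | z <- plus]
    <= 416)%N ->
  {subset [seq c + z | z <- plus] <= c :: s}.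
Proof.
set f := layered _ _ => s4.
have fc : f c = 8%N by rewrite /f /layered /= eqxx.
have f1 d : d \in steps -> (f (c + d)%R <= ((c + d)%R \in c :: s))%N.
  move=> ds; have cd : (c == c + d) = false.
    by rewrite -subr_eq0 opprD addNKr oppr_eq0; apply: contraTF ds => /eqP ->.
  case: (boolP ((c + d)%R \in c :: s)) => [|cs];
    last by rewrite /f layered_out //= s4.
  rewrite /f /layered /= cd; case: (index _ _) => [|[|[|[|]]]] //= k.
  by rewrite nth_nil.
(* The edge from c to c + d, seen from its outer end. *)
have g d : d \in steps -> ((8 - f (c + d)%R) ^ 2 <= local_energy f (c + d)%R)%N.
  rewrite -steps_opp => /(local_energy_ge f (c + d)); apply: leq_trans.
  by rewrite addrK fc leq_sqr; lia.
(* The four edges at c, seen from c. *)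
have g0 : ((8 - f (c + e1)%R) ^ 2 + (8 - f (c - e1)%R) ^ 2 +
    (8 - f (c + e2)%R) ^ 2 + (8 - f (c - e2)%R) ^ 2 <= local_energy f c)%N.
  rewrite /local_energy /= fc addn0 !addnA.
  by repeat apply: leq_add; rewrite leq_sqr; lia.
(* 49 and 64 = 49 + 15 are the squared drops from 8 to 1 and from 8 to 0. *)
have q d : d \in steps ->
    (49 + 15 * ((c + d)%R \notin c :: s) <= (8 - f (c + d)%R) ^ 2)%N.
  by move=> /f1; case: ((c + d)%R \in _); case: (f (c + d)%R) => [|[|]].
rewrite /energy /= addr0 => E.
have := (q e1 isT, q (- e1) isT, q e2 isT, q (- e2) isT).
have := (g e1 isT, g (- e1) isT, g e2 isT, g (- e2) isT).
move=> [[[G1 G2] G3] G4] [[[Q1 Q2] Q3] Q4].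
have : [&& c + e1 \in c :: s, c - e1 \in c :: s,
    c + e2 \in c :: s & c - e2 \in c :: s].
  move: Q1 Q2 Q3 Q4.
  case: ((c + e1)%R \in _); case: ((c - e1)%R \in _); case: ((c + e2)%R \in _);
    case: ((c - e2)%R \in _) => //=; lia.
move=> /and4P[i1 i2 i3 i4]; apply/allP => /=.
by rewrite mem_head i1 i2 i3 i4.
Qed.

(** A list of five points that contains a plus is that plus up to order, so the
    indicator is a translate of that of [plus], whose energy is computed. *)
Lemma energy_indicator_plus (c : Z2) (s : seq Z2) : uniq s -> size s = 5%N ->
  {subset [seq c + z | z <- plus] <= s} ->
  energy (layered s (nseq 5 1%N)) [seq c + z | z <- nbhd plus] = 24%N.
Proof.
move=> us s5 cs.
have cI : injective (fun z : Z2 => c + z) by exact: addrI.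
have ucp : uniq [seq c + z | z <- plus] by rewrite map_inj_uniq.
have s_le : (size s <= size [seq (c + z)%R | z <- plus])%N by rewrite s5.
have [_ cs_eq] := uniq_min_size ucp cs s_le.
have fE z : layered s (nseq 5 1%N) (c + z) = layered plus (nseq 5 1%N) z.
  rewrite /layered !nth_nseq -[X in (_ < X)%N](s5) index_mem -cs_eq.
  by rewrite mem_map // -[5%N]/(size plus) index_mem.
rewrite /energy -map_comp.
rewrite -[RHS]/(energy (layered plus (nseq 5 1%N)) (nbhd plus)).
congr sumn; apply: eq_map => z /=; rewrite /local_energy.
by congr sumn; apply: eq_map => d; rewrite -addrA !fE.
Qed.

Theorem theorem1p1 (R : realType) :
  ~ exists (prec : rel Z2) (x : nat -> Z2),
      [/\ strict_total_order prec,
          enumerates prec x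
        & forall u v : Z2 -> R,
            (forall z, 0 <= u z) ->
            vanishes_at_infinity u ->
            is_rearrangement x u v ->
            (grad_norm v <= grad_norm u)%E].
Proof.
move=> [prec [x [[irr _ _] [xlt _] H]]].
have xI : injective x.
  by move=> i j eqx; case: (ltngtP i j) => // /xlt; rewrite eqx irr.
have ut : uniq (mkseq x 5) by rewrite mkseq_uniq.
have ucp (K : seq Z2) : uniq K -> uniq [seq x 0%N + z | z <- K].
  by rewrite map_inj_uniq //; exact: addrI.
have spike := layered_energy_le R x plus _ [:: 8; 1; 1; 1; 1]%N xI H isT
  (ucp plus isT) erefl isT.
have sub : {subset [seq x 0%N + z | z <- plus] <= mkseq x 5}.
  exact: (@spike_neighbours (x 0%N) (map x (iota 1 4))).
have flat := layered_energy_le R x pentomino _ (nseq 5 1%N) xI H isT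
  (ucp _ (undup_uniq _)) erefl isT.
(* The pentomino has energy 2 * 10 = 20, less than 2 * 12 = 24. *)
by move: (flat (plus ++ [seq z + d | z <- plus, d <- steps]));
  rewrite energy_indicator_plus ?size_mkseq.
Qed.
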